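(* For almost all graphs $G$ of order $n$, $\mathcal{E}(G)=\left(\frac{4}{3\pi}+o(1)\right)n^{3/2}$. That is, for every $\varepsilon>0$, the proportion of graphs $G$ among all $2^{\binom{n}{2}}$ simple undirected graphs on the vertex set $\{1,\dots,n\}$ that satisfy $$\left|\frac{\mathcal{E}(G)}{n^{3/2}}-\frac{4}{3\pi}\right|<\varepsilon$$ tends to $1$ as $n\to\infty$.
   Context: For a simple undirected graph $G$ with adjacency matrix $A(G)$, the energy of $G$ is $\mathcal{E}(G)=\mathcal{E}(A(G))$, where the energy $\mathcal{E}(A)$ of a matrix $A$ is the sum of all its singular values (the square roots of the eigenvalues of $AA^{*}$, counted with multiplicity). Equivalently, $\mathcal{E}(G)$ is the sum of the absolute values of the eigenvalues of $A(G)$, counted with multiplicity. A property holds for almost all graphs if the random graph $G(n,1/2)$ (the uniformly random labeled graph on $n$ vertices, with each edge present independently with probability $1/2$) has it with probability tending to $1$ as $n\to\infty$. *)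

(* Defs.v *)
From HB Require Import structures.
From mathcomp Require Import all_boot all_order all_algebra.
From mathcomp Require Import complex.
From mathcomp Require Import all_classical all_reals all_analysis.

Set Implicit Arguments.
Unset Strict Implicit.
Unset Printing Implicit Defensive.

Import Order.TTheory GRing.Theory Num.Theory.
Import numFieldNormedType.Exports.

Local Open Scope ring_scope.
Local Open Scope sesquilinear_scope.
Local Open Scope complex_scope.

(* The vertex set {1, ..., n} is represented by 'I_n = {0, ..., n-1}; a simple
   undirected graph is its set of edges, each edge a two-element vertex set. *)
Record graph (n : nat) := Graph {
  edges :> {set {set 'I_n}};
  _ : edges \subset [set e : {set 'I_n} | #|e| == 2]
}.
HB.instance Definition _ n := [isSub for @edges n].
HB.instance Definition _ n := [Finite of graph n by <:].

(* Irreflexive because [set i; i] is a singleton. *)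
Definition adjacent n (G : graph n) : rel 'I_n :=
  fun i j => [set i; j] \in edges G.

Definition adjmx (C : pzRingType) n (G : graph n) : 'M[C]_n :=
  \matrix_(i, j) (adjacent G i j)%:R.

(* Listed with algebraic multiplicity: see eigenvaluesP. *)
Definition eigenvalues (C : numClosedFieldType) n (A : 'M[C]_n) : seq C :=
  sval (closed_field_poly_normal (char_poly A)).

Definition singular_values (C : numClosedFieldType) m n (A : 'M[C]_(m, n)) :
  seq C := [seq sqrtC x | x <- eigenvalues (A *m A ^t*)].

(* The singular values are nonnegative reals (singular_values_ge0), so
   complex.Re only changes the type of the sum: see energyE. *)
Definition energy (R : realType) m n (A : 'M[R[i]]_(m, n)) : R :=
  complex.Re (\sum_(s <- singular_values A) s).

Definition graph_energy (R : realType) n (G : graph n) : R :=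
  energy (adjmx R[i] G).

Definition proportion (R : realType) n (P : pred (graph n)) : R :=
  #|P|%:R / #|{: graph n}|%:R.

(* The probability under G(n, 1/2), i.e. under the uniform distribution on
   graph n, tends to 1. *)
Definition almost_all_graphs (R : realType) (P : forall n, pred (graph n)) :=
  ((fun n => proportion R (P n)) @ \oo --> (1 : R))%classic.

Lemma card_graph n : #|{: graph n}| = (2 ^ 'C(n, 2))%N.
Proof.
rewrite -cardsT -(card_imset _ val_inj) -[in RHS](card_ord n).
rewrite -card_draws -card_powerset.
apply: eq_card => G; rewrite !inE; apply/imsetP/idP => [[H _ ->]|sG].
  exact: valP H.
by exists (Graph sG).
Qed.

Lemma adjacent_sym n (G : graph n) : symmetric (adjacent G).
Proof. by move=> i j; rewrite /adjacent finset.setUC. Qed.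

Lemma adjacent_irr n (G : graph n) : irreflexive (adjacent G).
Proof.
move=> i; apply/negP; rewrite /adjacent finset.setUid => iG.
by have /fintype.subsetP/(_ _ iG) := valP G; rewrite inE cards1.
Qed.

Lemma eigenvaluesP (C : numClosedFieldType) n (A : 'M[C]_n) :
  char_poly A = \prod_(x <- eigenvalues A) ('X - x%:P).
Proof.
rewrite /eigenvalues; case: closed_field_poly_normal => r /= {1}->.
by rewrite (monicP (char_poly_monic A)) scale1r.
Qed.

Lemma singular_values_ge0 (C : numClosedFieldType) m n (A : 'M[C]_(m, n)) :
  {in singular_values A, forall s, 0 <= s}.
Proof.
move=> _ /mapP[x xA ->]; rewrite sqrtC_ge0.
have : root (char_poly (A *m A ^t*)) x by rewrite eigenvaluesP root_prod_XsubC.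
rewrite -eigenvalue_root_char => /eigenvalueP[v vA v0].
have nneg p (u : 'rV[C]_p) : 0 <= (u *m u ^t*) 0 0.
  rewrite mxE sumr_ge0 // => i _; rewrite !mxE; exact: mul_conjC_ge0.
have v_gt0 : 0 < (v *m v ^t*) 0 0.
  rewrite lt_def nneg andbT; apply: contra v0 => /eqP.
  rewrite mxE => /psumr_eq0P vv0; apply/eqP/rowP => i; rewrite [RHS]mxE.
  apply/eqP; rewrite -mul_conjC_eq0; have := vv0 _ i isT.
  rewrite !mxE => -> // j _; rewrite !mxE; exact: mul_conjC_ge0.
rewrite -(pmulr_lge0 _ v_gt0).
have -> : x * (v *m v ^t*) 0 0 = ((v *m A) *m (v *m A) ^t*) 0 0.
  by rewrite trmx_mul map_mxM /= !mulmxA -(mulmxA v) vA -scalemxAl [RHS]mxE.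
exact: nneg.
Qed.

Lemma energyE (R : realType) m n (A : 'M[R[i]]_(m, n)) :
  (energy A)%:C = \sum_(s <- singular_values A) s.
Proof.
rewrite /energy; apply: RRe_real; apply: ger0_real.
by rewrite big_seq sumr_ge0 // => s; apply: singular_values_ge0.
Qed.

(* Main.v *)
Require Import Defs.
From mathcomp Require Import all_boot all_order all_algebra.
From mathcomp Require Import complex ring lra zify.
From mathcomp Require Import all_classical all_reals all_analysis.
Import Order.TTheory GRing.Theory Num.Theory.
Import numFieldNormedType.Exports.
Local Open Scope ring_scope.

Set Implicit Arguments.
Unset Strict Implicit.
Unset Printing Implicit Defensive.

(** The energy of a random graph is governed by the semicircle law.

    Let W be the symmetric sign matrix with zero diagonal and entries +1 on
    edges, -1 on non-edges.  The adjacency matrix is W/2 + J/2 - I/2, with J the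
    all-ones matrix.  The energy of a real symmetric matrix is its trace norm,
    so by the triangle inequality ([energyD]) replacing A by W/2 changes the
    energy by at most n ([energy_adjmx_half]), which is o(n^(3/2)).

    It remains to show that the mean of |x| over the eigenvalues x of
    W / sqrt (n - 2) tends in probability to 8/(3 pi), the mean of |x| under the
    semicircle law on [-2, 2].  The Chebyshev polynomials U_j (U_0 = 1, U_1 = X,
    U_(j+2) = X U_(j+1) - U_j) are orthonormal for that law, so the law is
    characterised on polynomials by giving mean 0 to every U_j with j > 0.
    The off-diagonal entries of W have square 1, so U_j of the normalised matrix
    is, up to a multiple 1/(n-2) of U_(j-2), the normalised generating matrix of
    nonbacktracking walks of length j ([walkmx_chebmx]).  A closed
    nonbacktracking walk contains a cycle, so a pair of them from a common root
    that uses every edge an even number of times visits at most j vertices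
    ([even_closed_walk]); all other pairs have mean 0 by flipping one edge
    ([sum_walk_weight_odd]).  This makes the second moment of the mean of U_j of
    order 1/n ([sum_sqr_walkmx]), and the convergence follows for each U_j
    ([cvg_mean_chebyshev]), hence for all polynomials ([polynomial_mean]).

    Finally |x| is approximated by a polynomial on [-4, 4], and the error outside
    is dominated by a high even power of x/4, whose semicircle mean is tiny
    ([abs_approximation]); this bound holds for all real x, wherever the largest
    eigenvalues lie. *)

(** * The trace norm of Hermitian matrices *)

Section HermitianMatrices.
Variable C : numClosedFieldType.
Local Open Scope sesquilinear_scope.
Implicit Types n : nat.

Definition trace_norm n (A : 'M[C]_n) : C := \sum_(s <- singular_values A) s.

Lemma unitarymxK n (V : 'M[C]_n) : V \is unitarymx -> V *m V^t* = 1%:M.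
Proof. by move/unitarymxP. Qed.

Lemma unitarymxKV n (V : 'M[C]_n) : V \is unitarymx -> V^t* *m V = 1%:M.
Proof. by move/unitarymxK/mulmx1C. Qed.

Lemma unitary_conjM n (V D E : 'M[C]_n) : V \is unitarymx ->
  (V^t* *m D *m V) *m (V^t* *m E *m V) = V^t* *m (D *m E) *m V.
Proof.
move=> /unitarymxK VV.
by rewrite !mulmxA -[X in X *m E](mulmxA _ V) VV mulmx1.
Qed.

Lemma mxtrace_unitary_conj n (V D : 'M[C]_n) : V \is unitarymx ->
  \tr (V^t* *m D *m V) = \tr D.
Proof. by move=> /unitarymxK VV; rewrite -mulmxA mxtrace_mulC -mulmxA VV mulmx1. Qed.

Lemma char_poly_unitary_conj n (V D : 'M[C]_n) : V \is unitarymx ->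
  char_poly (V^t* *m D *m V) = char_poly D.
Proof.
move=> /unitarymxKV VV.
have VVp : map_mx polyC (V^t*) *m map_mx polyC V = 1%:M.
  by rewrite -map_mxM VV map_mx1.
rewrite /char_poly.
have -> : char_poly_mx (V^t* *m D *m V) =
    map_mx polyC (V^t*) *m char_poly_mx D *m map_mx polyC V.
  rewrite /char_poly_mx mulmxBr mulmxBl !map_mxM; congr (_ - _).
  by rewrite mul_mx_scalar -scalemxAl VVp scalemx1.
by rewrite !det_mulmx mulrAC -det_mulmx VVp det1 mul1r.
Qed.

Lemma hermitian_spectral n (A : 'M[C]_n) : A \is hermsymmx ->
  exists (V : 'M[C]_n) (d : 'rV[C]_n), [/\ V \is unitarymx,
    d \is a realmx & A = V^t* *m diag_mx d *m V].
Proof.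
move=> Ah; exists (spectralmx A), (spectral_diag A).
split; [exact: spectral_unitarymx|exact: hermitian_spectral_diag_real|].
rewrite -(invmx_unitary (spectral_unitarymx A)).
exact/orthomx_spectralP/hermitian_normalmx.
Qed.

Lemma conj_realmx n (d : 'rV[C]_n) i : d \is a realmx -> (d 0 i)^* = d 0 i.
Proof. by move/mxOverP=> dr; rewrite conj_Creal. Qed.

Lemma trace_norm_spectral n (V : 'M[C]_n) (d : 'rV[C]_n) :
  V \is unitarymx -> d \is a realmx ->
  trace_norm (V^t* *m diag_mx d *m V) = \sum_i `|d 0 i|.
Proof.
move=> Vu dr; rewrite /trace_norm /singular_values big_map.
set A := V^t* *m diag_mx d *m V.
have At : A^t* = A.
  rewrite /A !trmx_mul !map_mxM trmxCK mulmxA tr_diag_mx map_diag_mx.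
  congr (_ *m diag_mx _ *m _).
  by apply/rowP => i; rewrite !mxE; apply: conj_realmx.
rewrite At {1}/A unitary_conjM// mulmx_diag.
have : perm_eq (eigenvalues (V^t* *m diag_mx (\row_j (d 0 j * d 0 j)) *m V))
    [seq d 0 i * d 0 i | i <- enum 'I_n].
  apply: prod_XsubC_eq; rewrite -eigenvaluesP char_poly_unitary_conj//.
  rewrite char_poly_trig ?diag_mx_is_trig// big_map big_enum/=.
  by apply: eq_bigr => i _; rewrite !mxE eqxx mulr1n.
move/(perm_big _) ->; rewrite big_map big_enum/=.
by apply: eq_bigr => i _; rewrite normC_def conj_realmx.
Qed.

Lemma trace_norm_ge0 n (A : 'M[C]_n) : 0 <= trace_norm A.
Proof. by rewrite /trace_norm big_seq sumr_ge0// => s /singular_values_ge0. Qed.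

Lemma unitarymx_diag_le1 n (U : 'M[C]_n) i : U \is unitarymx -> `|U i i| <= 1.
Proof.
move=> /unitarymxK /matrixP /(_ i i); rewrite !mxE eqxx => UU.
rewrite -(ler_pXn2r (n := 2)) ?nnegrE// expr1n normCK -[leRHS]UU.
rewrite (bigD1 i)//= !mxE lerDl sumr_ge0// => j _.
by rewrite !mxE mul_conjC_ge0.
Qed.

(** In an eigenbasis of A the trace is a sum of eigenvalues weighted by diagonal
    entries of a unitary matrix, which have modulus at most 1. *)
Lemma trace_norm_dual n (A U : 'M[C]_n) : A \is hermsymmx ->
  U \is unitarymx -> `|\tr (A *m U)| <= trace_norm A.
Proof.
move=> /hermitian_spectral[V [d [Vu dr ->]]] Uu.
rewrite trace_norm_spectral// -!mulmxA mxtrace_mulC -!mulmxA.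
set W := V *m (U *m V^t*).
have Wu : W \is unitarymx.
  apply: mul_unitarymx => //; apply: mul_unitarymx => //.
  by rewrite trmxC_unitary.
rewrite mul_diag_mx /mxtrace; apply: le_trans (ler_norm_sum _ _ _) _.
apply: ler_sum => i _; rewrite mxE normrM ler_piMr//.
exact: unitarymx_diag_le1.
Qed.

(** The maximum in [trace_norm_dual] is reached at the sign of A, the unitary
    matrix with the same eigenbasis and eigenvalues 1 or -1. *)
Lemma trace_norm_attained n (A : 'M[C]_n) : A \is hermsymmx ->
  exists2 U : 'M[C]_n, U \is unitarymx & trace_norm A = \tr (A *m U).
Proof.
move=> /hermitian_spectral[V [d [Vu dr ->]]].
pose e : 'rV[C]_n := \row_i (if 0 <= d 0 i then 1 else -1).
exists (V^t* *m diag_mx e *m V).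
  apply: mul_unitarymx => //; apply: mul_unitarymx.
    by rewrite trmxC_unitary.
  apply/unitarymxP; rewrite tr_diag_mx map_diag_mx mulmx_diag.
  apply/matrixP => i j; rewrite !mxE; case: eqP => //= _; case: ifP => _.
    by rewrite rmorph1 mulr1.
  by rewrite rmorphN rmorph1 mulrNN mulr1.
rewrite trace_norm_spectral// unitary_conjM// mulmx_diag mxtrace_unitary_conj//.
rewrite mxtrace_diag; apply: eq_bigr => i _; rewrite !mxE.
case: ifPn => [d0|]; first by rewrite mulr1 ger0_norm.
by rewrite -real_ltNge ?real0 ?(mxOverP dr)// => /ltr0_norm->; rewrite mulrN1.
Qed.

Lemma trace_normD n (A B : 'M[C]_n) : A \is hermsymmx -> B \is hermsymmx ->
  A + B \is hermsymmx -> trace_norm (A + B) <= trace_norm A + trace_norm B.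
Proof.
move=> Ah Bh /trace_norm_attained[U Uu ABE].
rewrite -[leLHS](ger0_norm (trace_norm_ge0 _)) ABE mulmxDl linearD.
by apply: le_trans (ler_normD _ _) _; rewrite lerD// trace_norm_dual.
Qed.

(** All nonzero eigenvalues equal c, so they have the same sign. This computes
    the trace norms of the multiples of the identity and all-ones matrices
    without diagonalising them. *)
Lemma trace_norm_quasi_projection n (B : 'M[C]_n) c : B \is hermsymmx ->
  c \is Num.real -> B *m B = c *: B -> trace_norm B = `|\tr B|.
Proof.
move=> /hermitian_spectral[V [d [Vu dr BE]]] cr BB.
have dc i : d 0 i = 0 \/ d 0 i = c.
  have : diag_mx d *m diag_mx d = c *: diag_mx d.
    have DE : diag_mx d = V *m B *m V^t*.
      by rewrite BE !mulmxA unitarymxK// mul1mx -mulmxA unitarymxK// mulmx1.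
    rewrite DE !mulmxA -(mulmxA (V *m B)) unitarymxKV// mulmx1 -(mulmxA V) BB.
    by rewrite -scalemxAr -scalemxAl.
  rewrite mulmx_diag => /matrixP/(_ i i); rewrite !mxE eqxx !mulr1n.
  move=> /eqP; rewrite -subr_eq0 -mulrBl mulf_eq0 subr_eq0.
  by case/orP => /eqP; [right|left].
rewrite BE trace_norm_spectral// mxtrace_unitary_conj// mxtrace_diag.
have [c0|c0] := real_leP (real0 C) cr.
  have d0 i : 0 <= d 0 i by case: (dc i) => ->.
  by rewrite ger0_norm ?sumr_ge0//; apply: eq_bigr => i _; rewrite ger0_norm.
have d0 i : d 0 i <= 0 by case: (dc i) => ->//; exact: ltW.
rewrite ler0_norm ?sumr_le0// -sumrN.
by apply: eq_bigr => i _; rewrite ler0_norm.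
Qed.

End HermitianMatrices.

(** * Chebyshev polynomials of a matrix *)

Section Chebyshev.
Variable R : nzRingType.

(** The Chebyshev polynomials of the second kind, scaled to the interval
    [-2, 2]; the pair holds two consecutive terms of the recurrence. *)
Fixpoint chebyshev_pair j : {poly R} * {poly R} :=
  if j is j'.+1 then let: (a, b) := chebyshev_pair j' in (b, 'X * b - a)
  else (1, 'X).
Definition chebyshev j := (chebyshev_pair j).1.

Lemma chebyshevSS j : chebyshev j.+2 = 'X * chebyshev j.+1 - chebyshev j.
Proof. by rewrite /chebyshev /=; case: chebyshev_pair. Qed.

Fixpoint chebmx_pair n (X : 'M[R]_n) j : 'M[R]_n * 'M[R]_n :=
  if j is j'.+1 then let: (a, b) := chebmx_pair X j' in (b, X *m b - a)
  else (1%:M, X).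
Definition chebmx n (X : 'M[R]_n) j := (chebmx_pair X j).1.

Lemma chebmxSS n (X : 'M[R]_n) j :
  chebmx X j.+2 = X *m chebmx X j.+1 - chebmx X j.
Proof. by rewrite /chebmx /=; case: chebmx_pair. Qed.

End Chebyshev.
Arguments chebyshev {R} j.

Lemma nat_ind2 (P : nat -> Prop) :
  P 0 -> P 1 -> (forall j, P j -> P j.+1 -> P j.+2) -> forall j, P j.
Proof.
move=> P0 P1 PS j; suff: P j /\ P j.+1 by case.
by elim: j => // j [Pj Pj1]; split=> //; exact: PS.
Qed.

(** The spectral theorem needs complex entries; this moves traces computed there
    back to the real matrix. *)
Lemma chebmx_map (R S : nzRingType) (f : {rmorphism R -> S}) n (X : 'M[R]_n) j :
  map_mx f (chebmx X j) = chebmx (map_mx f X) j.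
Proof.
elim/nat_ind2: j => [||j IH0 IH1]; first exact: map_mx1.
  by [].
by rewrite !chebmxSS map_mxB map_mxM IH0 IH1.
Qed.

Lemma chebyshev_map (R S : comNzRingType) (f : {rmorphism R -> S}) x j :
  f (chebyshev j).[x] = (chebyshev j).[f x].
Proof.
elim/nat_ind2: j => [||j IH0 IH1]; first by rewrite !hornerE rmorph1.
  by rewrite !hornerX.
by rewrite !chebyshevSS !hornerE rmorphB rmorphM/= IH0 IH1.
Qed.

Lemma chebmx_spectral (C : numClosedFieldType) n (V : 'M[C]_n) (d : 'rV[C]_n) j :
  (V \is unitarymx -> chebmx (V ^t* *m diag_mx d *m V) j =
  V^t* *m diag_mx (\row_i (chebyshev j).[d 0 i]) *m V)%sesqui.
Proof.
move=> Vu; elim/nat_ind2: j => [||j IH0 IH1].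
- have -> : (\row_i (chebyshev 0).[d 0 i] = const_mx 1 :> 'rV[C]_n).
    by apply/rowP => i; rewrite !mxE hornerE.
  by rewrite diag_const_mx mulmx1 unitarymxKV.
- congr (_ *m diag_mx _ *m _)%sesqui.
  by apply/rowP => i; rewrite !mxE hornerX.
rewrite chebmxSS IH0 IH1 unitary_conjM// -mulmxBl -mulmxBr mulmx_diag -linearB.
congr (_ *m diag_mx _ *m _)%sesqui.
by apply/rowP => i; rewrite !mxE chebyshevSS !hornerE.
Qed.

(** * The energy of real symmetric matrices *)

Section RealSymmetric.
Variable R : realType.
Local Notation cmx := (map_mx (real_complex R)).
Local Open Scope complex_scope.

Lemma trace_normE n (A : 'M[R]_n) : trace_norm (cmx A) = (energy (cmx A))%:C.
Proof. by rewrite energyE. Qed.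

Lemma cmx_hermsym n (A : 'M[R]_n) : A^T = A -> cmx A \is hermsymmx.
Proof.
move=> As; apply: realsym_hermsym.
  by apply/is_hermitianmxP; rewrite expr0 scale1r map_mx_id// map_trmx As.
by apply/mxOverP => i j; rewrite mxE complex_real.
Qed.

Lemma energyD n (A B : 'M[R]_n) : A^T = A -> B^T = B ->
  energy (cmx (A + B)) <= energy (cmx A) + energy (cmx B).
Proof.
move=> As Bs; have ABs : (A + B)^T = A + B by rewrite linearD/= As Bs.
have := cmx_hermsym ABs; rewrite map_mxD => ABh.
have := trace_normD (cmx_hermsym As) (cmx_hermsym Bs) ABh.
rewrite -map_mxD !trace_normE.
by rewrite -[X in _ <= X](rmorphD (real_complex R)) lecR.
Qed.

Lemma energy_quasi_projection n (B : 'M[R]_n) c : B^T = B -> B *m B = c *: B ->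
  energy (cmx B) = `|\tr B|.
Proof.
move=> Bs BB; apply: complexI; rewrite -trace_normE.
rewrite (@trace_norm_quasi_projection _ _ _ c%:C) ?cmx_hermsym//.
- by rewrite trace_map_mx/= normc_def/= expr0n/= addr0 sqrtr_sqr.
- by rewrite complex_real.
- by rewrite -map_mxM BB map_mxZ.
Qed.

(** One list of real eigenvalues gives both the energy of A and the traces of the
    Chebyshev polynomials of all multiples of A. *)
Lemma symmetric_spectrum n (A : 'M[R]_n) : A^T = A ->
  exists d : 'rV[R]_n, energy (cmx A) = \sum_i `|d 0 i| /\
    forall c j, \tr (chebmx (c *: A) j) = \sum_i (chebyshev j).[c * d 0 i].
Proof.
move=> /cmx_hermsym/hermitian_spectral[V [d [Vu dr AE]]].
have dE i : d 0 i = (complex.Re (d 0 i))%:C by rewrite RRe_real// (mxOverP dr).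
exists (\row_i complex.Re (d 0 i)); split.
  apply: complexI; rewrite -trace_normE AE trace_norm_spectral// rmorph_sum.
  apply: eq_bigr => i _; rewrite mxE [in LHS]dE.
  by rewrite normc_def/= expr0n/= addr0 sqrtr_sqr.
move=> c j; apply: complexI; rewrite -trace_map_mx/= chebmx_map map_mxZ/= AE.
rewrite scalemxAl scalemxAr -linearZ/= chebmx_spectral// mxtrace_unitary_conj//.
rewrite mxtrace_diag rmorph_sum/=; apply: eq_bigr => i _.
by rewrite !mxE chebyshev_map rmorphM/= -dE.
Qed.

End RealSymmetric.

(** * Nonbacktracking walks and their vertices *)

Section Walks.
Variable T : finType.
Implicit Types (a b c : T) (p s : seq T).

(** Two steps along an edge and back are excluded, and so are loops. *)
Fixpoint nonbacktracking s : bool :=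
  if s is a :: p then (a \notin take 2 p) && nonbacktracking p else true.

Fixpoint walk_edges a p : seq {set T} :=
  if p is b :: p' then [set a; b] :: walk_edges b p' else [::].

Lemma size_walk_edges a p : size (walk_edges a p) = size p.
Proof. by elim: p a => //= b p IH a; rewrite IH. Qed.

Lemma walk_edges_sub a p e : e \in walk_edges a p -> {subset e <= a :: p}.
Proof.
elim: p a => //= b p IH a; rewrite inE => /predU1P[->|/IH eb] x.
  by rewrite !inE => /orP[|]->; rewrite ?orbT.
by move/eb => xb; rewrite inE xb orbT.
Qed.

Definition num_distinct (U : eqType) (s : seq U) := size (undup s).

Lemma num_distinct_cons (U : eqType) (x : U) (s : seq U) :
  num_distinct (x :: s) = ((x \notin s) + num_distinct s)%N.
Proof. by rewrite /num_distinct /=; case: ifP. Qed.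

Lemma new_vertex_new_edge a x b p : a \notin b :: p ->
  [set a; x] \notin walk_edges b p.
Proof.
by apply: contra => /walk_edges_sub/(_ a); apply; rewrite !inE eqxx.
Qed.

(** Prepending a step that reaches a new vertex also uses a new edge, so it
    preserves an inequality between these numbers. It is applied with k = 1 for
    connectedness and with k = 0 once the walk contains a cycle. *)
Lemma vertices_le_edges_cons a b p k :
  (num_distinct (b :: p) <= k + num_distinct (walk_edges b p))%N ->
  (num_distinct (a :: b :: p) <= k + num_distinct (walk_edges a (b :: p)))%N.
Proof.
move=> IH; rewrite num_distinct_cons [walk_edges a _]/= (num_distinct_cons [set a; b]).
case: (boolP (a \notin b :: p)) => [/new_vertex_new_edge->|_]; lia.
Qed.

Lemma vertices_le_edges a p :
  (num_distinct (a :: p) <= 1 + num_distinct (walk_edges a p))%N.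
Proof. by elim: p a => [//|b p IH a]; exact: vertices_le_edges_cons. Qed.

(** A nonbacktracking walk in a tree never returns. Take the shortest suffix that
    repeats a vertex: its first step closes a cycle, for it joins two vertices of
    a path along an edge that is not on the path, so it adds an edge but no
    vertex. *)
Lemma nonbacktracking_cycle a p : nonbacktracking (a :: p) -> ~~ uniq (a :: p) ->
  (num_distinct (a :: p) <= num_distinct (walk_edges a p))%N.
Proof.
elim: p a => [//|b p IH a] /andP[a2 bp].
case: (boolP (uniq (b :: p))) => [bu|bu _]; last first.
  by apply: (@vertices_le_edges_cons _ _ _ 0); exact: IH.
rewrite cons_uniq bu andbT negbK => abp.
have ab : [set a; b] \notin walk_edges b p.
  case: p abp bu a2 {IH bp} => [//|c p] abp /andP[bcp _].
  rewrite /= !inE !negb_or /= => /and3P[ab ac _]; apply/andP; split.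
    apply/negP => /eqP/setP/(_ a).
    by rewrite !inE eqxx (negPf ab) (negPf ac).
  by rewrite (finset.setUC [set a]) new_vertex_new_edge.
rewrite num_distinct_cons abp [walk_edges a _]/= (num_distinct_cons [set a; b]) ab.
exact: vertices_le_edges.
Qed.

Lemma even_count_num_distinct (U : eqType) (s : seq U) :
  (forall x, ~~ odd (count_mem x s)) -> (2 * num_distinct s <= size s)%N.
Proof.
move=> ev; rewrite -(perm_size (perm_count_undup s)) size_flatten /shape.
rewrite -map_comp sumnE big_map /num_distinct.
rewrite -sum1_size big_distrr/= big_seq [leqRHS]big_seq.
apply: leq_sum => x; rewrite mem_undup /= size_nseq -has_pred1 has_count.
by have := ev x; case: (count _ _) => [|[]].
Qed.

(** Each edge is used at least twice, so there are at most half as many edges as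
    steps; the cycle in the nonbacktracking part saves one vertex compared with
    a tree. This saving is what makes the traces negligible. *)
Lemma even_closed_walk a p q : p != [::] -> nonbacktracking (a :: p) ->
  last a p = a -> last a q = a ->
  (forall e, ~~ odd (count_mem e (walk_edges a (q ++ p)))) ->
  (2 * num_distinct (a :: q ++ p) <= size (q ++ p))%N.
Proof.
move=> p0 pnb pa qa /even_count_num_distinct; rewrite size_walk_edges.
apply: leq_trans; rewrite leq_pmul2l//.
elim: q {1 3 4}a qa => [b /= ->|c q IH b /= qc].
  apply: nonbacktracking_cycle => //=.
  case: p p0 pa {pnb} => //= b' p _ <-.
  by rewrite mem_last.
by apply: (@vertices_le_edges_cons _ _ _ 0); apply: IH.
Qed.

(** A sequence with at most j distinct entries is a map from its positions to
    'I_j followed by a map from 'I_j to T. *)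
Lemma card_few_distinct k j (x0 : T) : (0 < j)%N ->
  (#|[set t : k.-tuple T | num_distinct t <= j]| <= #|T| ^ j * j ^ k)%N.
Proof.
case: j => // j _.
(* The sequence is read off from its list of distinct entries. *)
pose f (gh : {ffun 'I_j.+1 -> T} * {ffun 'I_k -> 'I_j.+1}) : k.-tuple T :=
  [tuple gh.1 (gh.2 i) | i < k].
apply: leq_trans (_ : #|codom f| <= _)%N; last first.
  apply: leq_trans (leq_image_card _ _) _.
  by rewrite card_prod !card_ffun !card_ord.
apply/subset_leq_card/fintype.subsetP => t; rewrite inE => tj.
apply/codomP; exists ([ffun i : 'I_j.+1 => nth x0 (undup t) i],
  [ffun i => inord (index (tnth t i) (undup t))]).
apply: eq_from_tnth => i; rewrite tnth_mktuple !ffunE inordK.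
  by rewrite nth_index// mem_undup mem_tnth.
by apply: leq_trans tj; rewrite index_mem mem_undup mem_tnth.
Qed.

Lemma big_tupleS (A : Type) (idx : A) (op : Monoid.com_law idx) j
    (P : pred (seq T)) (F : seq T -> A) :
  \big[op/idx]_(p : j.+1.-tuple T | P p) F p =
  \big[op/idx]_x \big[op/idx]_(p : j.-tuple T | P (x :: p)) F (x :: p).
Proof.
rewrite pair_big_dep/=.
rewrite (reindex (fun xp : T * j.-tuple T => cons_tuple xp.1 xp.2))//=.
exists (fun t : j.+1.-tuple T => (thead t, behead_tuple t)) => [[x p] _|t _].
  by congr pair; apply: val_inj.
by rewrite [RHS]tuple_eta; apply: val_inj.
Qed.

End Walks.

(** * The matrix of nonbacktracking walks *)

Section WalkMatrix.
Variables (R : comNzRingType) (n : nat) (W : 'M[R]_n).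
Implicit Types (a b : 'I_n) (p : seq 'I_n).

Fixpoint walk_weight a p : R :=
  if p is b :: p' then W a b * walk_weight b p' else 1.

Lemma walk_weight_cat a p q :
  walk_weight a (p ++ q) = walk_weight a p * walk_weight (last a p) q.
Proof. by elim: p a => [|b p IH] a /=; rewrite ?mul1r// IH mulrA. Qed.

(** The entry (a, b) is the weighted sum of the nonbacktracking walks of length j
    from a to b. *)
Definition walkmx j : 'M[R]_n := \matrix_(a, b)
  \sum_(p : j.-tuple 'I_n | nonbacktracking (a :: p) && (last a p == b))
    walk_weight a p.

Lemma walkmx0 : walkmx 0 = 1%:M.
Proof.
apply/matrixP => a b; rewrite !mxE.
rewrite (eq_bigl (fun=> a == b)); last by move=> p; rewrite tuple0.
case: eqP => _; last by rewrite big_pred0.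
rewrite (eq_bigr (fun=> 1)) => [|p _]; last by rewrite tuple0.
by rewrite sumr_const card_tuple expn0.
Qed.

Hypothesis W0 : forall a, W a a = 0.
Hypothesis W1 : forall a b, a != b -> W a b * W b a = 1.

Lemma walkmx1 : walkmx 1 = W.
Proof.
apply/matrixP => a b; rewrite mxE.
rewrite (big_tupleS _ _ (fun p => nonbacktracking (a :: p) && (last a p == b))).
rewrite (bigD1 b)//= [X in _ + X]big1 ?addr0 => [|x xb]; last first.
  by rewrite big_pred0// => p; rewrite tuple0/= (negPf xb) andbF.
rewrite (eq_bigl (fun=> a != b)); last first.
  by move=> p; rewrite tuple0/= inE eqxx !andbT.
have [<-|ab] := eqVneq a b; first by rewrite big_pred0// W0.
rewrite (eq_bigr (fun=> W a b)) => [|p _]; last by rewrite tuple0/= mulr1.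
by rewrite sumr_const card_tuple expn0.
Qed.

(** A first step x followed by a nonbacktracking walk from x is nonbacktracking
    unless its second step goes straight back to a. In that case the two first
    steps have weight W a x * W x a = 1, and x is any vertex other than a and the
    next vertex of the walk, if there is one. *)
Lemma walkmxSS j :
  W *m walkmx j.+1 = walkmx j.+2 + (n - 1 - (0 < j))%:R *: walkmx j.
Proof.
apply/matrixP => a b; rewrite !mxE.
rewrite (big_tupleS _ _ (fun p => nonbacktracking (a :: p) && (last a p == b)))/=.
(* Both sides are sums over the first two steps x and y; split off y = a. *)
under [X in X = _]eq_bigr => x _ do rewrite mxE mulr_sumr
  (big_tupleS _ _ (fun p => nonbacktracking (x :: p) && (last x p == b))
     (fun p => W a x * walk_weight x p)) (bigD1 a)//= addrC.
under [X in _ = X + _]eq_bigr => x _ do rewrite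
  (big_tupleS _ _ (fun p => nonbacktracking (a :: x :: p) && (last x p == b))
     (fun p => walk_weight a (x :: p))) (bigD1 a)//= addrC.
rewrite !big_split/= -addrA; congr (_ + _).
  (* The terms with a = x, which only the left side has, vanish by W0. *)
  apply: eq_bigr => x _; apply: eq_bigr => y ya.
  have [->|ax] := eqVneq a x; first by rewrite !big1// => p _; rewrite W0 mul0r.
  by apply: eq_bigl => p; rewrite /= take0 !inE (negPf ax) [a == y]eq_sym (negPf ya).
rewrite [X in _ = X + _]big1 ?add0r => [|x _]; last first.
  by rewrite big_pred0// => p; rewrite !inE eqxx orbT.
rewrite (exchange_big_dep (fun p : j.-tuple 'I_n =>
  nonbacktracking (a :: p) && (last a p == b)))/=; last first.
  by move=> x p _ /andP[/andP[_ ->] ->].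
rewrite mulr_sumr; apply: eq_bigr => p /andP[pnb pb].
rewrite (eq_bigr (fun=> walk_weight a p)) => [|x /andP[/andP[xap _] _]]; last first.
  rewrite mulrA W1 ?mul1r//.
  by apply: contraNneq xap => <-; rewrite inE eqxx.
rewrite sumr_const mulr_natl; congr (_ *+ _).
rewrite (eq_card (B := [predC a :: take 1 p])); last first.
  have /andP[a2 qnb] := pnb => x; rewrite [LHS]unfold_in a2 qnb pb !andbT.
  by rewrite !inE.
have /card_uniqP s1 : uniq (a :: take 1 p).
  case: (tval p) pnb => [//|c q] /=; rewrite take0 !inE negb_or.
  by case/andP => /andP[-> _].
have := cardC (mem (a :: take 1 p)); rewrite card_ord s1.
rewrite (eq_card (B := [predC a :: take 1 p])) => [|x]; last by rewrite !inE.
have := size_tuple p; case: (tval p) => [|c q] <- /=; rewrite ?take0/=; lia.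
Qed.

End WalkMatrix.

(** The count n - 1 instead of n - 2 for walks of length 2 is the only
    deviation of [walkmxSS] from the Chebyshev recurrence; it propagates as the
    term with index j. *)
Lemma walkmx_chebmx (R : fieldType) n (W : 'M[R]_n.+2) (s : R) j :
  (forall a, W a a = 0) -> (forall a b, a != b -> W a b * W b a = 1) ->
  s ^+ 2 = n%:R -> s != 0 ->
  walkmx W j.+2 =
    s ^+ j.+2 *: (chebmx (s^-1 *: W) j.+2 - s ^- 2 *: chebmx (s^-1 *: W) j).
Proof.
move=> W0 W1 sn s0; set X := s^-1 *: W.
have WX : W = s *: X by rewrite scalerA divff// scale1r.
clearbody X.
have rec k : walkmx W k.+2 = s *: X *m walkmx W k.+1
    - (s ^+ 2 + (k == 0)%:R) *: walkmx W k.
  rewrite -WX (walkmxSS W0 W1) sn -natrD.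
  have -> : (n.+2 - 1 - (0 < k) = n + (k == 0%N))%N by case: k => [|k] /=; lia.
  by rewrite addrK.
elim/nat_ind2: j => [||j IH0 IH1].
- rewrite rec walkmx1// walkmx0 chebmxSS WX eqxx.
  rewrite -[chebmx X 1]/X -[chebmx X 0]/1%:M -scalemxAl -scalemxAr. 
  set A := X *m X; set I := 1%:M; rewrite /=; apply/matrixP => a b; rewrite !mxE; field; exact: s0.
- rewrite 2!rec walkmx1// walkmx0 WX eqxx/= chebmxSS (chebmxSS _ 0).
  rewrite -[chebmx X 1]/X -[chebmx X 0]/1%:M.
  rewrite !mulmxBr -!scalemxAl -!scalemxAr !mulmx1.
  set A := X *m (X *m X); apply/matrixP => a b; rewrite !mxE; field; exact: s0.
rewrite rec IH0 IH1 (chebmxSS _ j.+2) (chebmxSS _ j) addr0.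
rewrite -!scalemxAl -scalemxAr mulmxBr -scalemxAr.
set A := X *m _; set B := X *m _.
by apply/matrixP => a b; rewrite !mxE !exprS; field.
Qed.

(** * Random sign matrices *)

Section RandomSigns.
Variable R : realType.

Definition signmx n (G : graph n) : 'M[R]_n :=
  \matrix_(a, b) if a == b then 0 else (-1) ^+ ~~ Defs.adjacent G a b.

Lemma signmx_diag n (G : graph n) a : signmx G a a = 0.
Proof. by rewrite mxE eqxx. Qed.

Lemma signmxC n (G : graph n) a b : signmx G a b = signmx G b a.
Proof. by rewrite !mxE eq_sym adjacent_sym. Qed.

Lemma signmx_sym n (G : graph n) : (signmx G)^T = signmx G.
Proof. by apply/matrixP => a b; rewrite mxE signmxC. Qed.

Lemma signmx_sqr n (G : graph n) a b : a != b ->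
  signmx G a b * signmx G b a = 1.
Proof. by move=> ab; rewrite (signmxC G b) !mxE (negPf ab) -signr_addb addbb. Qed.

Lemma adjmx_signmx n (G : graph n) : adjmx R G =
  2^-1 *: signmx G + (2^-1 *: const_mx 1 + (- 2^-1) *: 1%:M).
Proof.
apply/matrixP => a b; rewrite !mxE; case: eqP => [->|_].
  by rewrite adjacent_irr /=; field.
by case: Defs.adjacent => /=; field.
Qed.

(** Symmetric difference with a single edge. The default value G is never reached
    when e has two elements. *)
Definition toggle n (e : {set 'I_n}) (G : graph n) : graph n :=
  insubd G [set f | (f \in edges G) (+) (f == e)].

Lemma edges_toggle n (e : {set 'I_n}) (G : graph n) f : #|e| == 2 ->
  (f \in edges (toggle e G)) = (f \in edges G) (+) (f == e).
Proof.
move=> e2; rewrite -[edges (toggle e G)]/(val (toggle e G)) insubdK ?inE//.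
rewrite unfold_in; apply/fintype.subsetP => x; rewrite !inE.
have := fintype.subsetP (valP G) x; rewrite !inE.
case: (x \in _) => [->//|_]; by move=> /eqP->.
Qed.

Lemma toggleK n (e : {set 'I_n}) : #|e| == 2 -> involutive (toggle e).
Proof.
move=> e2 G; apply/val_inj/setP => f /=.
by rewrite !edges_toggle// -addbA addbb addbF.
Qed.

Lemma walk_weight_toggle n (e : {set 'I_n}) (G : graph n) a p : #|e| == 2 ->
  walk_weight (signmx (toggle e G)) a p =
  (-1) ^+ (count_mem e (walk_edges a p)) * walk_weight (signmx G) a p.
Proof.
move=> e2; elim: p a => [a|b p IH a] /=; first by rewrite mul1r.
rewrite {}IH exprD mulrACA; congr (_ * _); rewrite !mxE.
case: eqP => _; first by rewrite mulr0.
rewrite /Defs.adjacent edges_toggle//; case: (_ == e); last by rewrite addbF mul1r.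
by rewrite addbT expr1 signrN mulN1r.
Qed.

(** An edge set that is not a pair comes from a step that stays in place, which
    has weight zero. *)
Lemma walk_weight_loop n (G : graph n) a p e :
  e \in walk_edges a p -> #|e| != 2 -> walk_weight (signmx G) a p = 0.
Proof.
elim: p a => //= b p IH a; rewrite inE => /predU1P[->|/IH{}IH /IH->].
  by rewrite cards2; have [<-|//] := eqVneq a b; rewrite signmx_diag mul0r.
by rewrite mulr0.
Qed.

(** If e is a pair of vertices, toggling it is a bijection on graphs that changes
    the sign of every term; otherwise every term is zero. *)
Lemma sum_walk_weight_odd n (a : 'I_n) p e : odd (count_mem e (walk_edges a p)) ->
  \sum_(G : graph n) walk_weight (signmx G) a p = 0.
Proof.
move=> oe; have [e2|e2] := boolP (#|e| == 2).
  apply/eqP; rewrite -[_ == 0](mulrn_eq0 _ 2)/= mulr2n addr_eq0.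
  rewrite [X in X == _](reindex_inj (inv_inj (toggleK e2))) -sumrN.
  apply/eqP; apply: eq_bigr => G _.
  by rewrite walk_weight_toggle// -signr_odd oe mulN1r.
apply: big1 => G _; apply: walk_weight_loop e2.
by rewrite -has_pred1 has_count; case: count oe.
Qed.

Lemma walk_weight_le1 n (G : graph n) a p : walk_weight (signmx G) a p <= 1.
Proof.
apply: le_trans (ler_norm _) _; elim: p a => [|b p IH] a /=; first by rewrite normr1.
rewrite normrM mulr_ile1// mxE; case: eqP => _; first by rewrite normr0.
by rewrite normr_sign.
Qed.

Lemma sum_walk_weight_closed n j (a : 'I_n) p q : (0 < j)%N ->
  size p = j -> size q = j -> nonbacktracking (a :: p) ->
  last a p = a -> last a q = a ->
  \sum_(G : graph n) walk_weight (signmx G) a (q ++ p) <=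
  #|{: graph n}|%:R * (num_distinct (a :: q ++ p) <= j)%N%:R.
Proof.
move=> j0 pj qj pnb pa qa.
have [[e oe]|ev] := pselect (exists e, odd (count_mem e (walk_edges a (q ++ p)))).
  by rewrite (sum_walk_weight_odd oe) mulr_ge0.
have := @even_closed_walk _ a p q _ pnb pa qa.
rewrite size_cat pj qj addnn -mul2n leq_pmul2l// => -> //.
- rewrite mulr1 -sum1_card natr_sum ler_sum// => G _.
  exact: walk_weight_le1.
- by case: p pj {pnb pa ev} j0 => //= <-.
- by move=> e; apply/negP => oe; apply: ev; exists e.
Qed.

Lemma sqr_sum_le n (x : 'I_n -> R) : (\sum_i x i) ^+ 2 <= n%:R * \sum_i x i ^+ 2.
Proof.
have : 0 <= \sum_i \sum_k (x i - x k) ^+ 2.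
  by apply: sumr_ge0 => i _; apply: sumr_ge0 => k _; exact: sqr_ge0.
rewrite (eq_bigr (fun i => (n%:R * x i ^+ 2 + \sum_k x k ^+ 2)
    - x i * (\sum_k x k) *+ 2)); last first.
  move=> i _; rewrite (eq_bigr (fun k => x i ^+ 2 + x k ^+ 2 - (x i * x k) *+ 2)).
    rewrite sumrB big_split/= sumr_const card_ord mulr_natl.
    by rewrite -mulrnAl mulr_sumr; congr (_ - _); apply: eq_bigr => k _; ring.
  by move=> k _; ring.
rewrite sumrB big_split/= sumr_const card_ord -mulr_sumr.
rewrite sumrMnl -mulr_suml -[_ *+ n]mulr_natl; lra.
Qed.

(** By Cauchy-Schwarz only products of two closed walks from a common vertex
    matter, and these are single closed walks of length j + j, whose vertex
    sequence has length (j + j).+1. *)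
Lemma sum_sqr_walkmx n j : (0 < j)%N ->
  \sum_(G : graph n) (\tr (walkmx (signmx G) j)) ^+ 2 <=
  #|{: graph n}|%:R * (n%:R * (n ^ j * j ^ (j + j).+1)%:R).
Proof.
move=> j0.
apply: le_trans (ler_sum _ (fun G _ => sqr_sum_le (fun i => walkmx (signmx G) j i i))) _.
rewrite -mulr_sumr mulrCA ler_wpM2l// exchange_big/=.
pose good (i : 'I_n) p q := (num_distinct (i :: q ++ p) <= j)%N.
apply: le_trans (_ : \sum_i \sum_(p : j.-tuple 'I_n) \sum_(q : j.-tuple 'I_n)
  #|{: graph n}|%:R * (good i p q)%:R <= _).
  apply: ler_sum => i _.
  under eq_bigr do rewrite mxE expr2 mulr_suml.
  rewrite exchange_big/= big_mkcond/=; apply: ler_sum => p _.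
  case: ifP => [/andP[pnb /eqP pi]|_]; last first.
    by apply: sumr_ge0 => q _; rewrite mulr_ge0.
  under eq_bigr do rewrite mulr_sumr.
  rewrite exchange_big/= big_mkcond/=; apply: ler_sum => q _.
  case: ifP => [/andP[_ /eqP qi]|_]; last by rewrite mulr_ge0.
  rewrite (eq_bigr (fun G => walk_weight (signmx G) i (q ++ p))).
    by apply: sum_walk_weight_closed; rewrite ?size_tuple.
  by move=> G _; rewrite walk_weight_cat qi mulrC.
under eq_bigr => i _ do under eq_bigr => p _ do rewrite -mulr_sumr.
under eq_bigr => i _ do rewrite -mulr_sumr.
rewrite -mulr_sumr ler_wpM2l//.
under eq_bigr => i _ do under eq_bigr => p _ do rewrite -natr_sum.
under eq_bigr => i _ do rewrite -natr_sum.
rewrite -natr_sum ler_nat.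
case: n @good => [|n] good; first by rewrite big_ord0.
have := @card_few_distinct _ (j + j).+1 j (ord0 : 'I_n.+1) j0.
rewrite card_ord; apply: leq_trans.
pose f (x : 'I_n.+1 * (j.-tuple 'I_n.+1 * j.-tuple 'I_n.+1)) : (j + j).+1.-tuple 'I_n.+1 :=
  [tuple of x.1 :: x.2.2 ++ x.2.1].
have finj : injective f.
  move=> [i [p q]] [i' [p' q']] /(congr1 val)/= [-> /eqP].
  by rewrite eqseq_cat ?size_tuple// => /andP[/eqP/val_inj-> /eqP/val_inj->].
under eq_bigr do rewrite pair_bigA/=.
rewrite pair_bigA/=.
rewrite (eq_bigr (fun x => if num_distinct (f x) <= j then 1 else 0)%N); last first.
  by move=> [i [p q]] _; rewrite /good/=; case: leqP.
rewrite -big_mkcond sum1_card -(card_imset _ finj).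
apply/subset_leq_card/fintype.subsetP => t /imsetP[x xg ->].
by rewrite inE.
Qed.

End RandomSigns.

(** * Convergence in probability over uniform graphs *)

Section ConvergenceInProbability.
Variable R : realType.
Implicit Types (P Q : forall n, pred (graph n)) (y z : forall n, graph n -> R).
Local Open Scope classical_set_scope.

Lemma squeeze_eventually (f g h : nat -> R) (l : R) (N : nat) :
  (forall n, (N <= n)%N -> f n <= g n <= h n) ->
  f @ \oo --> l -> h @ \oo --> l -> g @ \oo --> l.
Proof.
move=> fgh; apply: squeeze_cvgr; near=> n; apply: fgh.
by near: n; exact: nbhs_infty_ge.
Unshelve. all: by end_near. Qed.

Lemma graph_gt0 n : 0 < #|{: graph n}|%:R :> R.
Proof. by rewrite ltr0n card_graph expn_gt0. Qed.

Lemma proportion_le1 n (P : pred (graph n)) : proportion R P <= 1.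
Proof. by rewrite ler_pdivrMr ?graph_gt0// mul1r ler_nat max_card. Qed.

Lemma proportion_le n (P Q : pred (graph n)) :
  (forall G, P G -> Q G) -> proportion R P <= proportion R Q.
Proof.
move=> PQ; rewrite ler_wpM2r ?invr_ge0// ler_nat.
by apply/subset_leq_card/fintype.subsetP.
Qed.

Lemma almost_all_mono P Q (N : nat) : almost_all_graphs R P ->
  (forall n, (N <= n)%N -> forall G, P n G -> Q n G) -> almost_all_graphs R Q.
Proof.
rewrite /almost_all_graphs => aP PQ.
apply: (squeeze_eventually (N := N) _ aP (cvg_cst _)) => n Nn.
rewrite proportion_le1 andbT proportion_le//; exact: PQ.
Qed.

Lemma almost_all_and P Q : almost_all_graphs R P -> almost_all_graphs R Q ->
  almost_all_graphs R (fun n G => P n G && Q n G).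
Proof.
rewrite /almost_all_graphs => aP aQ.
apply: (squeeze_eventually (N := 0)
  (f := fun n => proportion R (P n) + proportion R (Q n) - 1) _ _ (cvg_cst _)).
  move=> n _; rewrite proportion_le1 andbT lerBlDr /proportion -mulrDl.
  rewrite ler_pdivrMr ?graph_gt0// mulrDl mul1r divfK ?gt_eqF ?graph_gt0//.
  rewrite -!natrD ler_nat -cardUI addnC leq_add ?max_card//.
have := cvgB (cvgD aP aQ) (cvg_cst (1 : R)); rewrite addrK; exact.
Qed.

Definition cvg_in_probability y (l : R) := forall d : R, 0 < d ->
  almost_all_graphs R (fun n G => `|y n G - l| < d).

Lemma cvg_in_probability_eventually y z l (N : nat) :
  (forall n, (N <= n)%N -> forall G, y n G = z n G) ->
  cvg_in_probability y l -> cvg_in_probability z l.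
Proof.
move=> yz yl d /yl yd; apply: (almost_all_mono (N := N) yd) => n Nn G.
by rewrite yz.
Qed.

Lemma cvg_in_probability_cst l : cvg_in_probability (fun _ _ => l) l.
Proof.
move=> d d0; rewrite /almost_all_graphs; under eq_cvg => n.
  have -> : proportion R (fun _ : graph n => `|l - l| < d) = 1.
    rewrite /proportion (eq_card (B := predT)) ?divff ?gt_eqF ?graph_gt0//.
    by move=> G; rewrite unfold_in subrr normr0 d0.
  over.
exact: cvg_cst.
Qed.

Lemma cvg_in_probability_lin a y z l m :
  cvg_in_probability y l -> cvg_in_probability z m ->
  cvg_in_probability (fun n G => a * y n G + z n G) (a * l + m).
Proof.
move=> yl zm d d0; have a1 : 0 < `|a| + 1 by rewrite ltr_wpDl.
have /yl yd : 0 < d / 2 / (`|a| + 1) by rewrite !divr_gt0.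
have /zm zd : 0 < d / 2 by rewrite divr_gt0.
apply: (almost_all_mono (N := 0) (almost_all_and yd zd)) => n _ G /andP[yG zG].
have -> : a * y n G + z n G - (a * l + m) = a * (y n G - l) + (z n G - m) by ring.
apply: le_lt_trans (ler_normD _ _) _; rewrite normrM [ltRHS]splitr.
apply: ler_ltD => //; move: yG; rewrite ltr_pdivlMr// => /ltW; apply: le_trans.
by rewrite mulrC ler_wpM2l// lerDl.
Qed.

Lemma cvg_in_probability_null (c : nat -> R) y l : c @ \oo --> 0 ->
  cvg_in_probability y l -> cvg_in_probability (fun n G => c n * y n G) 0.
Proof.
move=> c0 yl d d0; have l1 : 0 < `|l| + 1 by rewrite ltr_wpDl.
have /cvgr0Pnorm_lt/(_ _ (divr_gt0 d0 l1))[N _ cN] := c0.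
apply: (almost_all_mono (N := N) (yl 1 ltr01)) => n Nn G yG.
rewrite subr0 normrM.
have yl1 : `|y n G| <= `|l| + 1.
  rewrite -[y n G](subrK l) addrC; apply: le_trans (ler_normD _ _) _.
  by rewrite lerD2l ltW.
apply: le_lt_trans (ler_wpM2l (normr_ge0 _) yl1) _.
by rewrite -ltr_pdivlMr//; exact: cN.
Qed.

(** Chebyshev's inequality. *)
Lemma chebyshev_in_probability y (b : nat -> R) (N : nat) :
  (forall n, (N <= n)%N -> \sum_(G : graph n) y n G ^+ 2 <= #|{: graph n}|%:R * b n) ->
  b @ \oo --> 0 -> cvg_in_probability y 0.
Proof.
move=> yb b0 d d0.
apply: (squeeze_eventually (N := N)
  (f := fun n => 1 - b n / d ^+ 2) _ _ (cvg_cst _)).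
  move=> n Nn; rewrite proportion_le1 andbT.
  rewrite /proportion ler_pdivlMr ?graph_gt0// mulrBl mul1r lerBlDl -lerBlDr.
  rewrite -(cardC (fun G => `|y n G - 0| < d)) natrD addrAC subrr add0r.
  rewrite mulrAC ler_pdivlMr ?exprn_gt0// [leRHS]mulrC.
  rewrite -natrD cardC; apply: le_trans _ (yb n Nn).
  rewrite -sum1_card natr_sum mulr_suml big_mkcond/=; apply: ler_sum => G _.
  rewrite mul1r inE; case: ifP => [|_]; last exact: sqr_ge0.
  rewrite unfold_in subr0 -leNgt => dy.
  by rewrite -[leRHS]real_normK ?num_real// ler_pXn2r ?nnegrE// ltW.
have := cvgB (cvg_cst (1 : R)) (cvgM b0 (cvg_cst ((d ^+ 2)^-1 : R))).
by rewrite mul0r subr0; exact.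
Qed.

End ConvergenceInProbability.

(** * Eigenvalue means of Chebyshev polynomials *)

Section EmpiricalSpectrum.
Variable R : realType.
Local Open Scope classical_set_scope.

Lemma half_signmx_sym n (G : graph n) :
  (2^-1 *: signmx R G)^T = 2^-1 *: signmx R G.
Proof. by rewrite linearZ/= signmx_sym. Qed.

(** The eigenvalues of half the sign matrix, which is the matrix that is compared
    with the adjacency matrix. *)
Definition half_spectrum n (G : graph n) : 'rV[R]_n :=
  sval (cid (symmetric_spectrum (half_signmx_sym G))).

(** The coefficient in [walkmxSS] is n - 2 for all but the shortest walks, so this
    normalisation makes the Chebyshev recurrence hold up to one exact term; it
    differs from sqrt n by a factor tending to 1. *)
Definition scale n : R := Num.sqrt (n - 2)%:R.

(** The factor 2 turns eigenvalues of half the sign matrix into eigenvalues of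
    the sign matrix itself. *)
Definition eigenvalue_mean (f : R -> R) n (G : graph n) : R :=
  n%:R^-1 * \sum_i f (2 / scale n * half_spectrum G 0 i).

Lemma energy_half_spectrum n (G : graph n) :
  energy (map_mx (real_complex R) (2^-1 *: signmx R G)) =
  \sum_i `|half_spectrum G 0 i|.
Proof. by rewrite /half_spectrum; case: cid => d []. Qed.

Lemma eigenvalue_mean_chebyshev j n (G : graph n) :
  eigenvalue_mean (horner (chebyshev j)) G =
  n%:R^-1 * \tr (chebmx ((scale n)^-1 *: signmx R G) j).
Proof.
rewrite /eigenvalue_mean /half_spectrum; case: cid => d [/= _ <-].
by rewrite scalerA mulrAC divff// mul1r.
Qed.

Lemma scale_gt0 n : (2 < n)%N -> 0 < scale n.
Proof. by move=> n2; rewrite sqrtr_gt0 ltr0n subn_gt0. Qed.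

Lemma scale_sqr n : scale n ^+ 2 = (n - 2)%:R.
Proof. by rewrite sqr_sqrtr. Qed.

Lemma cvg_invn : (fun n => n%:R^-1 : R) @ \oo --> 0.
Proof. by rewrite -cvg_shiftS; exact: cvg_harmonic. Qed.

Lemma cvg_scaleV2 : (fun n => scale n ^- 2) @ \oo --> 0.
Proof.
rewrite -(cvg_shiftn 2).
have -> : (fun n => scale (n + 2) ^- 2) = (fun n => n%:R^-1).
  by apply/funext => n; rewrite scale_sqr addnK.
exact: cvg_invn.
Qed.

(** The second moment is O(1/n); the bound n <= 3 (n - 2) compares the powers of n
    in [sum_sqr_walkmx] with the normalisation. *)
Lemma cvg_mean_walkmx j : (0 < j)%N -> cvg_in_probability (fun n G =>
  n%:R^-1 * (scale n ^- j * \tr (walkmx (signmx R G) j))) 0.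
Proof.
move=> j0; apply: (@chebyshev_in_probability _ _
  (fun n => (3 ^ j * j ^ (j + j).+1)%:R * n%:R^-1) 3).
  move=> n n3; under eq_bigr do rewrite mulrA exprMn.
  rewrite -mulr_sumr.
  apply: le_trans (ler_wpM2l (sqr_ge0 _) (sum_sqr_walkmx R n j0)) _.
  rewrite mulrCA ler_wpM2l//.
  have n0 : 0 < n%:R :> R by rewrite ltr0n; lia.
  have N0 : 0 < (n - 2)%:R ^+ j :> R by rewrite exprn_gt0// ltr0n; lia.
  have sj : scale n ^- j ^+ 2 = ((n - 2)%:R ^+ j)^-1.
    by rewrite exprVn -exprM mulnC exprM scale_sqr.
  rewrite exprMn sj !natrM natrX.
  set K : R := (j ^ _)%:R; set N := (n - 2)%:R in sj N0 *.
  rewrite [leLHS](_ : _ = n%:R ^+ j / N ^+ j * (K / n%:R)); last first.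
    by field; rewrite !gt_eqF.
  rewrite -[leRHS]mulrA ler_wpM2r ?divr_ge0// ler_pdivrMr//.
  rewrite natrX -exprMn lerXn2r ?nnegrE ?mulr_ge0 ?ler0n// /N -natrM ler_nat.
  lia.
by have := cvgM (cvg_cst ((3 ^ j * j ^ (j + j).+1)%:R : R)) cvg_invn; rewrite mulr0; exact.
Qed.

(** By [walkmx_chebmx] the mean of U_(j+2) is a normalised trace of a walk matrix
    plus 1/(n-2) times the mean of U_j, and both tend to 0. *)
Lemma cvg_mean_chebyshev j : cvg_in_probability
  (eigenvalue_mean (horner (chebyshev j))) (j == 0)%:R.
Proof.
elim/nat_ind2: j => [||j IH _].
- apply: (cvg_in_probability_eventually (N := 1) _ (cvg_in_probability_cst _)).
  move=> n n1 G; rewrite eigenvalue_mean_chebyshev [chebmx _ _]/(1%:M).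
  by rewrite mxtrace1 mulVf// pnatr_eq0; lia.
- apply: (cvg_in_probability_eventually (N := 0) _ (cvg_in_probability_cst _)).
  move=> n n1 G; rewrite eigenvalue_mean_chebyshev [chebmx _ 1]/(_ *: _).
  rewrite linearZ/= /mxtrace big1 ?mulr0// => i _; exact: signmx_diag.
have := cvg_in_probability_lin 1 (cvg_mean_walkmx (ltn0Sn j.+1))
  (cvg_in_probability_null cvg_scaleV2 IH).
rewrite mul1r addr0; apply: (cvg_in_probability_eventually (N := 3)) => n n3 G.
rewrite !eigenvalue_mean_chebyshev mul1r [X in _ + X]mulrCA -mulrDr.
congr (_ * _).
have s0 := gt_eqF (scale_gt0 n3).
case: n n3 G s0 => [|[|n]]// n3 G s0.
rewrite (@walkmx_chebmx _ _ _ (scale n.+2)).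
- rewrite linearZ linearB linearZ/= mulKf ?expf_neq0 ?s0//; ring.
- exact: signmx_diag.
- exact: signmx_sqr.
- by rewrite scale_sqr subn2.
- by rewrite s0.
Qed.

Lemma eigenvalue_mean_lin a p q n (G : graph n) :
  eigenvalue_mean (horner (a *: p + q)) G =
  a * eigenvalue_mean (horner p) G + eigenvalue_mean (horner q) G.
Proof.
rewrite /eigenvalue_mean [in RHS]mulrCA -mulrDr; congr (_ * _).
rewrite mulr_sumr -big_split/=.
by apply: eq_bigr => i _; rewrite !hornerE.
Qed.

End EmpiricalSpectrum.

(** * Means under the semicircle law *)

Section Semicircle.
Variable R : realType.
Implicit Types (p q : {poly R}) (l m : R).

(** After the substitution x = 2 cos t the semicircle law on [-2, 2] has density
    2 sin^2 t / pi on [0, pi], and l is the mean of p. A primitive F stands for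
    the integral, so that the mean value theorem suffices to compare means. *)
Definition semicircle_mean p l := exists F : R -> R,
  (forall t : R, is_derive t 1 F (p.[2 * cos t] * sin t ^+ 2)) /\
  F pi - F 0 = l * (pi / 2).

Lemma semicircle_mean_lin a p q l m : semicircle_mean p l ->
  semicircle_mean q m -> semicircle_mean (a *: p + q) (a * l + m).
Proof.
move=> [F [dF FE]] [G [dG GE]]; exists (a \*: F + G); split=> [t|].
  have := is_deriveD (is_deriveZ a (dF t)) (dG t).
  move/is_derive_eq; apply; rewrite hornerD hornerZ /GRing.scale/=; ring.
have -> : (a * l + m) * (pi / 2) = a * (l * (pi / 2)) + m * (pi / 2) by ring.
rewrite -FE -GE.
rewrite -[(a \*: F + G) pi]/(a * F pi + G pi) -[(a \*: F + G) 0]/(a * F 0 + G 0).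
ring.
Qed.

Lemma sin_pi_natmul k : sin (k%:R * pi) = 0 :> R.
Proof.
elim: k => [|k IH]; first by rewrite mul0r sin0.
by rewrite -natr1 mulrDl mul1r sinD sinpi IH mulr0 mul0r addr0.
Qed.

(** The defining property of Chebyshev polynomials of the second kind. *)
Lemma chebyshev_sin j (t : R) :
  (chebyshev j).[2 * cos t] * sin t = sin (j.+1%:R * t).
Proof.
elim/nat_ind2: j => [||j IH0 IH1]; first by rewrite -[chebyshev 0]/(1%:P) hornerC !mul1r.
  have -> : 2%:R * t = t + t by ring.
  by rewrite hornerX sinD; ring.
rewrite chebyshevSS hornerD hornerN hornerM hornerX mulrBl -mulrA IH0 IH1.
have -> : j.+3%:R * t = j.+2%:R * t + t by rewrite -[j.+3%:R]natr1; ring.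
have -> : j.+1%:R * t = j.+2%:R * t - t.
  by rewrite -[j.+2%:R]natr1; ring.
rewrite sinB sinD; ring.
Qed.

Lemma is_derive_sin_natmul (k : nat) (t : R) :
  is_derive t 1 (fun t : R => sin (k%:R * t)) (k%:R * cos (k%:R * t)).
Proof.
have dk : is_derive t (1 : R) (fun t : R => k%:R * t) k%:R.
  have := is_deriveZ (k%:R : R) (is_derive_id t (1 : R)).
  by move/is_derive_eq; apply; rewrite /= /GRing.scale/= mulr1.
have := is_derive1_comp (is_derive_sin (k%:R * t)) dk.
by move/is_derive_eq; apply; rewrite mulrC.
Qed.

Lemma semicircle_mean_chebyshev j : semicircle_mean (chebyshev j) (j == 0)%:R.
Proof.
have dE t : (chebyshev j).[2 * cos t] * sin t ^+ 2 =
    2^-1 * (cos (j%:R * t) - cos (j.+2%:R * t)) :> R.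
  rewrite expr2 mulrA chebyshev_sin.
  have -> : j%:R * t = j.+1%:R * t - t by rewrite -[j.+1%:R]natr1; ring.
  have -> : j.+2%:R * t = j.+1%:R * t + t by rewrite -[j.+2%:R]natr1; ring.
  by rewrite cosB cosD; field.
case: j dE => [|j] dE.
  exists (fun t => 2^-1 * t - 4^-1 * sin (2%:R * t)); split=> [t|]; last first.
    by rewrite !mulr0 sin_pi_natmul sin0/=; field.
  rewrite dE; have := is_deriveB (is_deriveZ (2^-1 : R) (is_derive_id t (1 : R)))
    (is_deriveZ (4^-1 : R) (is_derive_sin_natmul 2 t)).
  move/is_derive_eq; apply.
  by rewrite /GRing.scale/= mul0r cos0; field.
exists (fun t => (2 * j.+1%:R)^-1 * sin (j.+1%:R * t) -
  (2 * j.+3%:R)^-1 * sin (j.+3%:R * t)); split=> [t|]; last first.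
  by rewrite !mulr0 !sin_pi_natmul sin0 !mulr0 mul0r subrr.
rewrite dE; have := is_deriveB
  (is_deriveZ ((2 * j.+1%:R)^-1 : R) (is_derive_sin_natmul j.+1 t))
  (is_deriveZ ((2 * j.+3%:R)^-1 : R) (is_derive_sin_natmul j.+3 t)).
move/is_derive_eq; apply; rewrite /GRing.scale/=.
by field; rewrite !gt_eqF// ltr_wpDr.
Qed.

Lemma derive_bounded_increment (f df : R -> R) (a b B : R) : a < b ->
  (forall t : R, is_derive t (1 : R) f (df t)) ->
  (forall t : R, a < t < b -> `|df t| <= B) -> `|f b - f a| <= B * (b - a).
Proof.
move=> ab fd dfB.
have cf : {within `[a, b], continuous f}%classic.
  by apply: derivable_within_continuous => t _; apply: ex_derive.
have [c] := @MVT _ f df a b ab (fun t _ => fd t) cf.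
rewrite in_itv/= => cab ->; rewrite normrM (gtr0_norm (x := b - a)) ?subr_gt0//.
by rewrite ler_wpM2r ?dfB// subr_ge0 ltW.
Qed.

Lemma is_derive_sin_cube (t : R) :
  is_derive t 1 (fun t : R => 2 / 3 * sin t ^+ 3) (2 * cos t * sin t ^+ 2).
Proof.
have := is_deriveZ (2 / 3 : R) (is_deriveX 3 (is_derive_sin t)).
by move/is_derive_eq; apply; rewrite /GRing.scale/=; field.
Qed.

Lemma sin_sqr_le1 (t : R) : sin t ^+ 2 <= 1.
Proof. by rewrite sin2cos2 lerBlDr lerDl sqr_ge0. Qed.

(** For |x| the integrand |2 cos t| sin^2 t has the primitive (2/3) sin^3 t on
    [0, pi/2] and its opposite on [pi/2, pi], which gives the mean 8/(3 pi). The
    constant c covers both p close to |x| (c = 1) and p small (c = 0). *)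
Lemma semicircle_mean_abs p l (c B : R) : semicircle_mean p l ->
  (forall x : R, `|x| <= 2 -> `|p.[x] - c * `|x| | <= B) ->
  `|l - c * (8 / (3 * pi))| <= 2 * B.
Proof.
move=> [F [dF FE]] pB; have pi0 := pi_gt0 R.
have cos2 t : `|2 * cos t| <= 2 :> R.
  by rewrite normrM ger0_norm// ler_piMr// ler_norml cos_geN1 cos_le1.
have dB (k : R) (t : R) : `|2 * cos t| = k * (2 * cos t) ->
    `|p.[2 * cos t] * sin t ^+ 2 - c * k * (2 * cos t * sin t ^+ 2)| <= B.
  move=> kt; rewrite [X in `|X|](_ : _ = (p.[2 * cos t] - c * `|2 * cos t|) * sin t ^+ 2).
    rewrite normrM [X in _ * X]ger0_norm ?sqr_ge0//.
    apply: le_trans (pB _ (cos2 t)); rewrite ler_piMr// sin_sqr_le1//.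
  by rewrite kt; ring.
have dH (k t : R) := is_deriveB (dF t) (is_deriveZ (c * k : R) (is_derive_sin_cube t)).
have p2 : 0 < pi / 2 :> R by rewrite divr_gt0.
have p2p : pi / 2 < pi :> R by rewrite ltr_pdivrMr// ltr_pMr// ltr1n.
have h1 : `|F (pi / 2) - F 0 - c * (2 / 3)| <= B * (pi / 2).
  have H (t : R) : 0 < t < pi / 2 -> `|2 * cos t| = 1 * (2 * cos t).
    move=> /andP[t0 tp]; rewrite mul1r ger0_norm// mulr_ge0//.
    by rewrite cos_ge0_pihalf// (ltW tp) andbT; lra.
  have := derive_bounded_increment p2 (dH 1) (fun t tI => dB 1 t (H t tI)).
  rewrite subr0; congr (`| _ | <= _).
  transitivity ((F (pi / 2) - c * 1 * (2 / 3 * sin (pi / 2) ^+ 3)) -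
    (F 0 - c * 1 * (2 / 3 * sin 0 ^+ 3))); first by [].
  by rewrite sin0 sin_pihalf; ring.
have h2 : `|F pi - F (pi / 2) - c * (2 / 3)| <= B * (pi / 2).
  have H (t : R) : pi / 2 < t < pi -> `|2 * cos t| = -1 * (2 * cos t).
    move=> /andP[t0 tp]; rewrite mulN1r ler0_norm// pmulr_rle0//.
    by rewrite -oppr_ge0 -sinBpihalf sin_ge0_pi//; apply/andP; split; lra.
  have := derive_bounded_increment p2p (dH (-1)) (fun t tI => dB (-1) t (H t tI)).
  have -> : pi - pi / 2 = pi / 2 :> R by field.
  congr (`| _ | <= _).
  transitivity ((F pi - c * -1 * (2 / 3 * sin pi ^+ 3)) -
    (F (pi / 2) - c * -1 * (2 / 3 * sin (pi / 2) ^+ 3))); first by [].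
  by rewrite sinpi sin_pihalf; ring.
have piN0 : pi != 0 :> R by rewrite gt_eqF.
have -> : l - c * (8 / (3 * pi)) = (2 / pi) *
    ((F (pi / 2) - F 0 - c * (2 / 3)) + (F pi - F (pi / 2) - c * (2 / 3))).
  have -> : F (pi / 2) - F 0 - c * (2 / 3) + (F pi - F (pi / 2) - c * (2 / 3)) =
      (F pi - F 0) - c * (4 / 3) by field.
  by rewrite FE; move: (@pi R) piN0 => x x0; field.
have -> : 2 * B = 2 / pi * (B * (pi / 2) + B * (pi / 2)).
  by move: (@pi R) piN0 => x x0; field.
rewrite normrM ger0_norm ?divr_ge0 ?(ltW pi0)//.
rewrite ler_wpM2l ?divr_ge0 ?(ltW pi0)//.
by apply: le_trans (ler_normD _ _) _; exact: lerD.
Qed.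

(** The property is linear and holds for the Chebyshev polynomials. It extends to
    X^k U_j by induction on k, since X U_(j+1) = U_(j+2) + U_j. *)
Lemma polynomial_mean p : exists2 l, semicircle_mean p l &
  cvg_in_probability (eigenvalue_mean (horner p)) l.
Proof.
pose good p := exists2 l, semicircle_mean p l &
  cvg_in_probability (eigenvalue_mean (horner p)) l.
have good_cheb j : good (chebyshev j).
  exists (j == 0)%:R; first exact: semicircle_mean_chebyshev.
  exact: cvg_mean_chebyshev.
have good_lin a q r : good q -> good r -> good (a *: q + r).
  move=> [l ql cl] [m rm cm]; exists (a * l + m).
    exact: semicircle_mean_lin.
  apply: (cvg_in_probability_eventually (N := 0)
    _ (cvg_in_probability_lin a cl cm)) => n _ G.
  by rewrite eigenvalue_mean_lin.
have good_mono k j : good ('X^k * chebyshev j).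
  elim: k j => [|k IH] j; first by rewrite expr0 mul1r.
  case: j => [|j]; first by have := IH 1; rewrite exprSr mulr1.
  have := good_lin 1 _ _ (IH j.+2) (IH j).
  by rewrite scale1r -mulrDr chebyshevSS subrK mulrA -exprSr.
rewrite -/(good p) -[p]coefK poly_def.
have good0 : good 0 by have := good_lin (-1) _ _ (good_cheb 0) (good_cheb 0);
  rewrite scaleN1r addNr.
elim/big_ind: _ => [//|q r gq gr|i _].
  by have := good_lin 1 _ _ gq gr; rewrite scale1r.
by have := good_lin p`_i _ _ (good_mono i 0) good0; rewrite addr0 mulr1.
Qed.

End Semicircle.

(** * Polynomial approximation of the absolute value *)

Section AbsoluteValue.
Variable R : realType.
Implicit Types (p q : {poly R}) (e t x : R).

(** Iterative approximation of the square root of t^2. *)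
Fixpoint abs_poly k : {poly R} :=
  if k is k'.+1 then abs_poly k' + 2^-1 *: ('X^2 - abs_poly k' ^+ 2) else 0.

(** The error u satisfies u' <= u (1 - u/2), which forces u = O(1/k). *)
Lemma abs_polyP k t : `|t| <= 1 ->
  0 <= (abs_poly k).[t] <= `|t| /\ `|t| - (abs_poly k).[t] <= 2 / k.+1%:R.
Proof.
move=> t1; have t0 := normr_ge0 t.
elim: k => [|k [/andP[p0 pt] pk]]; first by rewrite horner0 lexx t0; split=> //; lra.
have -> : (abs_poly k.+1).[t] =
    (abs_poly k).[t] + 2^-1 * (`|t| ^+ 2 - (abs_poly k).[t] ^+ 2).
  by rewrite /= !hornerE real_normK ?num_real.
move: (`|t|) (_.[t]) t0 t1 p0 pt pk => a b a0 a1 b0 ba bk.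
split; first by apply/andP; split; nra.
have [k0 k1] : 0 < k.+1%:R :> R /\ 0 < k.+2%:R :> R by [].
have {bk} bk : (a - b) * k.+1%:R <= 2 by rewrite -ler_pdivlMr.
rewrite ler_pdivlMr//; apply: le_trans (_ : (a - b) * (1 - (a - b) / 2) * k.+2%:R <= _).
  by rewrite ler_pM2r//; nra.
rewrite -[k.+2%:R]natr1; move: (k.+1%:R : R) bk => j bk.
(* With u = a - b, the goal is 2 - (2 - u j)(1 - u/2) - u^2/2 <= 2. *)
have : 0 <= (2 - (a - b) * j) * (1 - (a - b) / 2) by rewrite mulr_ge0//; lra.
have := sqr_ge0 (a - b); lra.
Qed.

Lemma horner_growth p : exists2 C : R, 0 <= C & forall (m : nat) t,
  (size p <= m)%N -> 1 <= `|t| -> `|p.[t]| <= C * `|t| ^+ m.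
Proof.
exists (\sum_(i < size p) `|p`_i|); first exact: sumr_ge0.
move=> m t pm t1; rewrite horner_coef mulr_suml.
apply: le_trans (ler_norm_sum _ _ _) _; apply: ler_sum => i _.
rewrite normrM normrX ler_wpM2l// ler_weXn2l//.
by rewrite ltnW// (leq_trans _ pm).
Qed.

(** On [-4, 4] rescale [abs_poly]; beyond, the error is at most a constant times
    |x/4|^(2m) for all large m by [horner_growth]. This power is at most 4^(-m) on
    [-2, 2], so its constant is compensated by the choice of m. *)
Lemma abs_approximation e : 0 < e -> exists p q, [/\
  forall x, `|p.[x] - `|x| | <= q.[x],
  forall x, `|x| <= 2 -> `|p.[x] - `|x| | <= e &
  forall x, `|x| <= 2 -> `|q.[x]| <= e].
Proof.
move=> e0.
have [k kE] : exists k, 8 / k.+1%:R <= e / 2.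
  exists (Num.truncn (16 / e)); rewrite ler_pdivrMr//.
  have := truncnS_gt (16 / e); rewrite ltr_pdivrMr// => H; lra.
have [C C0 CP] := horner_growth (abs_poly k).
have [M ME] : exists M : nat, 8 * (C + 1) / e <= 4 ^+ M.
  exists (Num.truncn (8 * (C + 1) / e)).+1.
  apply: le_trans (ltW (truncnS_gt _)) _.
  by rewrite -natrX ler_nat ltnW// ltn_expl.
pose m := (size (abs_poly k) + M).+1.
pose p := 4 *: (abs_poly k \Po (4^-1 *: 'X)).
pose q := (e / 2)%:P + (4 * (C + 1)) *: (4^-1 *: 'X) ^+ (m + m).
have pE x : p.[x] = 4 * (abs_poly k).[4^-1 * x].
  by rewrite /p hornerZ horner_comp hornerZ hornerX.
have qE x : q.[x] = e / 2 + 4 * (C + 1) * (4^-1 * `|x|) ^+ (m + m).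
  rewrite /q hornerD hornerC hornerZ horner_exp hornerZ hornerX.
  rewrite -[in RHS](ger0_norm (x := 4^-1))// -normrM addnn -muln2 mulnC !exprM.
  by rewrite real_normK ?num_real.
have x4 x : `|x| = 4 * `|4^-1 * x|.
  by rewrite normrM ger0_norm// mulrA divff// mul1r.
have small x : `|x| <= 4 -> `|p.[x] - `|x| | <= e / 2.
  move=> xle; rewrite pE x4.
  have t1 : `|4^-1 * x| <= 1 by rewrite -(ler_pM2l (x := 4))// -x4 mulr1.
  have [/andP[_ b1] b2] := abs_polyP k t1.
  rewrite -mulrBr normrM ger0_norm// ler0_norm ?subr_le0// opprB.
  apply: le_trans kE; rewrite [leRHS](_ : _ = 4 * (2 / k.+1%:R)); last by field.
  by rewrite ler_wpM2l.
have tail x : 0 <= 4 * (C + 1) * (4^-1 * `|x|) ^+ (m + m).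
  by rewrite !mulr_ge0 ?addr_ge0// exprn_ge0// mulr_ge0.
exists p, q; split=> x.
- rewrite qE; have [xle|xgt] := lerP `|x| 4.
    by apply: le_trans (small x xle) _; rewrite lerDl tail.
  have t1 : 1 <= `|4^-1 * x| by rewrite -(ler_pM2l (x := 4))// -x4 mulr1 ltW.
  apply: le_trans (_ : 4 * (C + 1) * (4^-1 * `|x|) ^+ (m + m) <= _); last first.
    by rewrite lerDr divr_ge0// ltW.
  rewrite pE [in leLHS]x4 -mulrBr normrM ger0_norm// -mulrA ler_wpM2l//.
  rewrite -[X in (X * `|x|)](ger0_norm (x := 4^-1))// -normrM.
  apply: le_trans (ler_normB _ _) _; rewrite normr_id mulrDl mul1r.
  apply: lerD; first by apply: CP => //; rewrite /m; lia.
  by rewrite -[leLHS]expr1 ler_weXn2l// /m; lia.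
- by move=> x2; apply: le_trans (small x _) _; lra.
move=> x2; rewrite qE ger0_norm; last by rewrite addr_ge0 ?tail ?divr_ge0// ltW.
rewrite [leRHS]splitr lerD2l.
have h : (4^-1 * `|x|) ^+ (m + m) <= 4^-1 ^+ M.
  have x0 := normr_ge0 x.
  apply: le_trans (_ : 2^-1 ^+ (m + m) <= _).
    by apply: lerXn2r; rewrite ?nnegrE ?mulr_ge0//; lra.
  rewrite addnn -muln2 mulnC exprM [2^-1 ^+ 2](_ : _ = 4^-1); last by field.
  by rewrite ler_wiXn2l// ?invf_le1 ?ler1n// /m; lia.
apply: le_trans (ler_wpM2l _ h) _; first by rewrite mulr_ge0 ?addr_ge0.
rewrite exprVn ler_pdivrMr ?exprn_gt0//.
by move: ME; rewrite ler_pdivrMr//; lra.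
Qed.

End AbsoluteValue.

(** * The energy of almost all graphs *)

Section Main.
Variable R : realType.

(** With p and q from [abs_approximation], the means of p and q differ from their
    semicircle means by little, and the mean of |x| from that of p by at most the
    mean of q. *)
Lemma cvg_mean_abs : cvg_in_probability
  (eigenvalue_mean (fun x : R => `|x|)) (8 / (3 * pi)).
Proof.
move=> d d0; have e0 : 0 < d / 6 by rewrite divr_gt0.
have [p [q [pq p2 q2]]] := abs_approximation e0.
have [l pl cl] := polynomial_mean p; have [m qm cm] := polynomial_mean q.
have lE : `|l - 1 * (8 / (3 * pi))| <= 2 * (d / 6).
  by apply: semicircle_mean_abs pl _ => x /p2; rewrite mul1r.
have mE : `|m - 0 * (8 / (3 * pi))| <= 2 * (d / 6).
  by apply: semicircle_mean_abs qm _ => x /q2; rewrite mul0r subr0.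
move: lE mE; rewrite mul1r mul0r subr0 => lE mE.
apply: (almost_all_mono (N := 0) (almost_all_and (cl _ e0) (cm _ e0))).
move=> n _ G /andP[lG mG].
have dist : `|eigenvalue_mean (horner p) G - eigenvalue_mean (fun x => `|x|) G| <=
    eigenvalue_mean (horner q) G.
  rewrite /eigenvalue_mean -mulrBr normrM ger0_norm ?invr_ge0//.
  rewrite ler_wpM2l ?invr_ge0// -sumrB.
  by apply: le_trans (ler_norm_sum _ _ _) _; apply: ler_sum => i _; exact: pq.
move: dist lG mG lE mE; move: (eigenvalue_mean (horner p) G)
  (eigenvalue_mean (horner q) G) (eigenvalue_mean _ G) (8 / _) => a b z L.
rewrite !ler_norml !ltr_norml => /andP[h1 h2] /andP[h3 h4] /andP[h5 h6].
move=> /andP[h7 h8] /andP[h9 h10].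
by apply/andP; split; lra.
Qed.

Lemma dist_le_of_triangle (a h x y N : R) :
  a <= h + x -> x <= N / 2 + N / 2 -> h <= a + y -> y <= N / 2 + N / 2 ->
  `|a - h| <= N.
Proof. by move=> *; rewrite ler_distl; apply/andP; split; lra. Qed.

(** The matrices J/2 and -I/2 that separate the adjacency matrix from half the
    sign matrix have trace norm n/2 each. *)
Lemma energy_adjmx_half n (G : graph n) :
  `|graph_energy R G -
    energy (map_mx (real_complex R) (2^-1 *: signmx R G))| <= n%:R.
Proof.
have -> : graph_energy R G = energy (map_mx (real_complex R) (adjmx R G)).
  rewrite /graph_energy; congr energy; apply/matrixP => i j.
  by rewrite !mxE rmorph_nat.
set H := 2^-1 *: signmx R G.
pose J : 'M[R]_n := 2^-1 *: const_mx 1; pose I : 'M[R]_n := (- 2^-1) *: 1%:M.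
have Hs : H^T = H by rewrite half_signmx_sym.
have As : (adjmx R G)^T = adjmx R G.
  by apply/matrixP => i j; rewrite !mxE adjacent_sym.
have Js : J^T = J by apply/matrixP => i j; rewrite !mxE.
have Is : I^T = I by rewrite linearZ/= trmx1.
have AE : adjmx R G = H + (J + I) by rewrite adjmx_signmx.
have HE : H = adjmx R G + ((-1) *: J + (-1) *: I).
  by rewrite AE !scaleN1r -opprD addrK.
have JJ : J *m J = (n%:R / 2) *: J.
  apply/matrixP => i j; rewrite !mxE (eq_bigr (fun=> 2^-1 * 2^-1)) => [|k _].
    by rewrite sumr_const card_ord -[LHS]mulr_natl; ring.
  by rewrite !mxE !mulr1.
have II : I *m I = (- 2^-1) *: I by rewrite -scalemxAl mul1mx.
have trJ : `|\tr J| = n%:R / 2.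
  rewrite linearZ/= /mxtrace (eq_bigr (fun=> 1)) => [|i _]; last by rewrite mxE.
  by rewrite sumr_const card_ord ger0_norm mulrC// mulr_ge0.
have trI : `|\tr I| = n%:R / 2.
  by rewrite linearZ/= mxtrace1 mulNr normrN ger0_norm mulrC// mulr_ge0.
have EJ := energy_quasi_projection Js JJ.
have EI := energy_quasi_projection Is II.
have sN (B : 'M[R]_n) : B^T = B -> (-1 *: B)^T = -1 *: B.
  by move=> Bs; rewrite linearZ/= Bs.
have qN (B : 'M[R]_n) c : B *m B = c *: B -> (-1 *: B) *m (-1 *: B) = (- c) *: (-1 *: B).
  by move=> BB; rewrite !scaleN1r mulmxN mulNmx opprK BB scaleNr scalerN opprK.
have EJN := energy_quasi_projection (sN _ Js) (qN _ _ JJ).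
have EIN := energy_quasi_projection (sN _ Is) (qN _ _ II).
move: EJN EIN; rewrite ![\tr (-1 *: _)]linearZ/= !mulN1r !normrN => EJN EIN.
have sD (B D : 'M[R]_n) : B^T = B -> D^T = D -> (B + D)^T = B + D.
  by move=> Bs Ds; rewrite linearD/= Bs Ds.
have u1 := energyD Hs (sD _ _ Js Is); have u2 := energyD Js Is.
have v1 := energyD As (sD _ _ (sN _ Js) (sN _ Is)).
have v2 := energyD (sN _ Js) (sN _ Is).
rewrite -AE in u1; rewrite -HE in v1.
rewrite EJ EI trJ trI in u2; rewrite EJN EIN trJ trI in v2.
exact: dist_le_of_triangle u1 u2 v1 v2.
Qed.

Lemma powR_3half n : n%:R `^ (3 / 2) = n%:R * Num.sqrt n%:R :> R.
Proof.
have [->|n0] := posnP n; first by rewrite mul0r powR0// gt_eqF// divr_gt0.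
have -> : 3 / 2 = 1 + 2^-1 :> R by field.
by rewrite powRD ?pnatr_eq0 -?lt0n ?n0 ?implybT// powRr1// powR12_sqrt.
Qed.

Lemma sqrt_gt n (M : R) : 0 <= M -> (Num.truncn (M ^+ 2) < n)%N ->
  M < Num.sqrt n%:R.
Proof.
move=> M0 Mn; rewrite -(ger0_norm M0) -sqrtr_sqr ltr_sqrt ?ltr0n; last by lia.
by apply: lt_le_trans (truncnS_gt _) _; rewrite ler_nat.
Qed.

(** The last estimate, with r = sqrt n, s = sqrt (n - 2), Z the eigenvalue mean of
    |x| and L its limit; the error is at most 3/r plus half of |Z - L|. *)
Lemma energy_ratio_dist (E s r Z L eps : R) : 0 < s -> 0 < r ->
  s ^+ 2 = r ^+ 2 - 2 -> 1 <= r ^+ 2 -> `|E - s / 2 * (r ^+ 2 * Z)| <= r ^+ 2 ->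
  `|Z - L| < eps -> 0 <= L -> L <= 4 / 3 -> 3 / r < eps / 2 ->
  `|E / (r ^+ 2 * r) - L / 2| < eps.
Proof.
move=> s0 r0 sr r1 EZ ZL L0 L1 re.
have r1' : 1 <= r by rewrite -(@ler_pXn2r _ 2) ?nnegrE ?expr1n// ltW.
have sler : s <= r by rewrite -(@ler_pXn2r _ 2) ?nnegrE ?ltW// sr; lra.
have rN0 : r != 0 by rewrite gt_eqF.
have -> : E / (r ^+ 2 * r) - L / 2 = (E - s / 2 * (r ^+ 2 * Z)) / (r ^+ 2 * r) +
    (s / r / 2 * (Z - L) - L / 2 * (1 - s / r)) by field.
have h1 : `|(E - s / 2 * (r ^+ 2 * Z)) / (r ^+ 2 * r)| <= r^-1.
  rewrite normrM [X in _ * X]ger0_norm ?invr_ge0 ?mulr_ge0 ?exprn_ge0 ?(ltW r0)//.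
  rewrite ler_pdivrMr ?mulr_gt0 ?exprn_gt0//.
  by rewrite [leRHS]mulrCA mulVf// mulr1.
have h2 : `|s / r / 2 * (Z - L)| <= 2^-1 * `|Z - L|.
  rewrite normrM ler_wpM2r// ger0_norm ?divr_ge0 ?(ltW s0) ?(ltW r0)//.
  by rewrite -[leRHS]mul1r ler_wpM2r// ler_pdivrMr// mul1r.
have h3 : 0 <= 1 - s / r <= 2 * r^-1.
  rewrite subr_ge0 ler_pdivrMr// mul1r sler/=.
  rewrite [leLHS](_ : _ = (r - s) * r^-1); last by field.
  rewrite ler_wpM2r ?invr_ge0 ?(ltW r0)//.
  have : (r - s) * (r + s) = 2 by rewrite -subr_sqr sr; ring.
  nra.
have h4 : `|L / 2 * (1 - s / r)| <= 2 * r^-1.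
  case/andP: h3 => h3 h3'; rewrite normrM !ger0_norm ?divr_ge0//.
  by rewrite -[leRHS]mul1r ler_pM ?divr_ge0//; lra.
apply: le_lt_trans (ler_normD _ _) _.
have := ler_normB (s / r / 2 * (Z - L)) (L / 2 * (1 - s / r)).
move: h1 h2 h4 re ZL => /=.
move: (`|_ / (r ^+ 2 * r)|) (`|_ * _ - _ * _|) (`|_ * (Z - L)|) (`|_ * (1 - _)|) => x y z w.
by move: (r^-1) (`|Z - L|) => u v; lra.
Qed.

End Main.

Theorem mainTheorem4 (R : realType) (eps : R) (heps : 0 < eps) :
  almost_all_graphs R (fun n (G : graph n) =>
    `|graph_energy R G / (n%:R `^ (3 / 2)) - 4 / (3 * pi)| < eps).
Proof.
pose M := Num.truncn ((6 / eps) ^+ 2).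
apply: (almost_all_mono (N := maxn 3 M.+1) (@cvg_mean_abs R _ heps)) => n.
rewrite geq_max => /andP[n3 nM] G; rewrite powR_3half => ZL.
have n0 : 0 < n%:R :> R by rewrite ltr0n; lia.
have rn0 : 0 < Num.sqrt n%:R :> R by rewrite sqrtr_gt0.
have rneps : 3 / Num.sqrt n%:R < eps / 2.
  have : 6 / eps < Num.sqrt n%:R by apply: sqrt_gt => //; rewrite divr_ge0 ?ltW.
  by rewrite ltr_pdivrMr// ltr_pdivrMr//; lra.
have s0 := @scale_gt0 R n n3.
have EZ : energy (map_mx (real_complex R) (2^-1 *: signmx R G)) =
    scale R n / 2 * (n%:R * eigenvalue_mean (fun x : R => `|x|) G).
  rewrite energy_half_spectrum /eigenvalue_mean mulVKf ?gt_eqF// mulr_sumr.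
  apply: eq_bigr => i _; rewrite normrM ger0_norm ?divr_ge0 ?ltW//.
  by rewrite mulrA; set h := `|_|; field; rewrite gt_eqF.
have := energy_adjmx_half R G; rewrite {}EZ.
have ss : scale R n ^+ 2 = n%:R - 2.
  by rewrite scale_sqr natrB//; lia.
have nn : Num.sqrt n%:R ^+ 2 = n%:R :> R by rewrite sqr_sqrtr.
have L0 : 0 < 8 / (3 * pi) :> R by rewrite divr_gt0 ?mulr_gt0 ?pi_gt0.
have L1 : 8 / (3 * pi) <= 4 / 3 :> R.
  rewrite ler_pdivrMr ?mulr_gt0 ?pi_gt0//; have := pi_ge2 R; lra.
have LE : 4 / (3 * pi) = 8 / (3 * pi) / 2 :> R.
  by move: (@pi R) (pi_gt0 R) => x x0; field; rewrite gt_eqF.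
have := @energy_ratio_dist R (graph_energy R G) (scale R n) (Num.sqrt n%:R)
  (eigenvalue_mean (fun x : R => `|x|) G) (8 / (3 * pi)) eps.
rewrite LE nn => ratio dist; apply: ratio => //; last exact: ltW.
by rewrite ler1n; lia.
Qed.
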